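(* The class $\mathsf{TMD}$ is closed under group extensions: if $G$ is a topological group, $H\trianglelefteq G$ is a closed normal subgroup, and both $H\in\mathsf{TMD}$ and $G/H\in\mathsf{TMD}$, then also $G\in\mathsf{TMD}$.
   Context: All topological spaces (and topological groups) are Hausdorff and regular; $H$ has the subspace topology and $G/H$ the quotient topology. For a topological group $G$, a $G$-flow is a compact space with a continuous left $G$-action $G\times X\to X$; it is minimal if every orbit is dense. The universal minimal flow $\mathrm{M}(G)$ is the (unique up to isomorphism) minimal $G$-flow which admits a continuous $G$-equivariant map onto every minimal $G$-flow. For a symmetric open neighborhood $U$ of $e_G$ and a $G$-flow $X$, a nonempty open $A\subseteq X$ is $U$-TT if $A\subseteq\overline{UB}$ for every nonempty open $B\subseteq A$. $G$ has tractable minimal dynamics, written $G\in\mathsf{TMD}$, if $\mathrm{M}(G)$ satisfies the Rosendal criterion: for every symmetric open neighborhood $U$ of $e_G$, every nonempty open $A\subseteq\mathrm{M}(G)$ contains a nonempty open $U$-TT set. *)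

(* Defs.v *)
From HB Require Import structures.
From mathcomp Require Import all_boot all_classical.
From mathcomp Require Import topology_structure compact separation_axioms.
From mathcomp Require Import initial_topology product_topology.
From mathcomp Require Import subtype_topology quotient_topology.

Set Implicit Arguments.
Unset Strict Implicit.
Unset Printing Implicit Defensive.

Local Open Scope classical_set_scope.
Local Open Scope group_scope.
Local Open Scope quotient_scope.

#[local] Set SsrOldRewriteGoalsOrder.

(* No separation axiom is part of this structure: Hausdorffness and regularity
   are stated separately, through [hausdorff_space] and [regular_space]. *)
HB.mixin Record isTopologicalGroup G of Group G & Topological G := {
  mulg_continuous : continuous (fun xy : G * G => xy.1 * xy.2);
  invg_continuous : continuous (fun x : G => x^-1)
}.

#[short(type="topologicalGroupType")]
HB.structure Definition TopologicalGroup :=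
  {G of isTopologicalGroup G & Group G & Topological G}.

Lemma continuous_mulg (G : topologicalGroupType) (T : topologicalType)
    (f g : T -> G) :
  continuous f -> continuous g -> continuous (fun x => f x * g x).
Proof.
move=> cf cg x.
by apply: (@continuous2_cvg _ _ _ _ _ _ f g (fun x y => x * y)) (cf x) (cg x);
  exact: (@mulg_continuous G (f x, g x)).
Qed.

Lemma continuous_invg (G : topologicalGroupType) (T : topologicalType)
    (f : T -> G) :
  continuous f -> continuous (fun x => (f x)^-1).
Proof.
move=> cf x; apply: (@continuous_comp _ _ _ f (fun x : G => x^-1)) (cf x) _.
exact: invg_continuous.
Qed.

Record normalSubgroup (G : groupType) := NormalSubgroup {
  nsg_set :> set G;
  nsg1 : nsg_set 1;
  nsgM : forall x y, nsg_set x -> nsg_set y -> nsg_set (x * y);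
  nsgV : forall x, nsg_set x -> nsg_set x^-1;
  nsgJ : forall x g, nsg_set x -> nsg_set (x ^ g)
}.

(* [set_type H] already carries the subspace topology, and [quotient_topology]
   below the quotient topology; only the group structures are missing. *)

Section Subgroup.
Context (G : topologicalGroupType) (H : normalSubgroup G).
Implicit Types x y z : set_type H.

Lemma nsg_valP x : nsg_set H (set_val x).
Proof. exact/set_mem/valP. Qed.

Definition subgroup_one : set_type H := exist _ 1 (mem_set (nsg1 H)).

Definition subgroup_mul x y : set_type H :=
  exist _ (set_val x * set_val y) (mem_set (nsgM (nsg_valP x) (nsg_valP y))).

Definition subgroup_inv x : set_type H :=
  exist _ (set_val x)^-1 (mem_set (nsgV (nsg_valP x))).

Lemma subgroup_val_inj : injective (set_val : set_type H -> G).
Proof. exact: val_inj. Qed.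

Lemma subgroup_mulA : associative subgroup_mul.
Proof. by move=> x y z; apply: subgroup_val_inj; exact: mulgA. Qed.

Lemma subgroup_mul1 : left_id subgroup_one subgroup_mul.
Proof. by move=> x; apply: subgroup_val_inj; exact: mul1g. Qed.

Lemma subgroup_1mul : right_id subgroup_one subgroup_mul.
Proof. by move=> x; apply: subgroup_val_inj; exact: mulg1. Qed.

Lemma subgroup_mulV : left_inverse subgroup_one subgroup_inv subgroup_mul.
Proof. by move=> x; apply: subgroup_val_inj; exact: mulVg. Qed.

Lemma subgroup_Vmul : right_inverse subgroup_one subgroup_inv subgroup_mul.
Proof. by move=> x; apply: subgroup_val_inj; exact: mulgV. Qed.

HB.instance Definition _ := isGroup.Build (set_type H)
  subgroup_mulA subgroup_mul1 subgroup_1mul subgroup_mulV subgroup_Vmul.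

Lemma subgroup_val_continuous : continuous (set_val : set_type H -> G).
Proof. exact: initial_continuous. Qed.

Lemma subgroup_continuous (T : topologicalType) (f : T -> set_type H) :
  continuous (set_val \o f) -> continuous f.
Proof.
move=> /continuousP cf; apply/continuousP => _ [B oB <-].
by rewrite -comp_preimage; exact: cf.
Qed.

Lemma subgroup_mulg_continuous :
  continuous (fun xy : set_type H * set_type H => xy.1 * xy.2).
Proof.
apply: subgroup_continuous.
have -> : set_val \o (fun xy : set_type H * set_type H => xy.1 * xy.2) =
    (fun xy => set_val xy.1 * set_val xy.2) by [].
apply: continuous_mulg => -[x y].
- by apply: (@continuous_comp _ _ _ fst set_val);
    [exact: cvg_fst|exact: subgroup_val_continuous].
- by apply: (@continuous_comp _ _ _ snd set_val);
    [exact: cvg_snd|exact: subgroup_val_continuous].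
Qed.

Lemma subgroup_invg_continuous : continuous (fun x : set_type H => x^-1).
Proof.
apply: subgroup_continuous.
have -> : set_val \o (fun x : set_type H => x^-1) =
    (fun x => (set_val x)^-1) by [].
exact: continuous_invg subgroup_val_continuous.
Qed.

HB.instance Definition _ := isTopologicalGroup.Build (set_type H)
  subgroup_mulg_continuous subgroup_invg_continuous.
End Subgroup.

Section CosetRelation.
Context (G : groupType) (H : normalSubgroup G).

Definition coset_rel (x y : G) : bool := x^-1 * y \in (H : set G).

Lemma coset_rel_refl : reflexive coset_rel.
Proof. by move=> x; rewrite /coset_rel mulVg; apply/mem_set; exact: nsg1. Qed.

Lemma coset_rel_sym : symmetric coset_rel.
Proof.
suff imp x y : coset_rel x y -> coset_rel y x by move=> x y; apply/idP/idP => /imp.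
by move=> /set_mem/nsgV; rewrite invgM invgK => /mem_set.
Qed.

Lemma coset_rel_trans : transitive coset_rel.
Proof.
move=> y x z /set_mem Hxy /set_mem Hyz; apply/mem_set.
by have := nsgM Hxy Hyz; rewrite mulgA mulgK.
Qed.

Canonical coset_equiv :=
  EquivRel coset_rel coset_rel_refl coset_rel_sym coset_rel_trans.

Definition quotient_group : Type := quotient_topology {eq_quot coset_equiv}.

End CosetRelation.

Section QuotientGroup.
Context (G : topologicalGroupType) (H : normalSubgroup G).
Local Notation Q := (quotient_group H).

HB.instance Definition _ := Topological.on Q.
HB.instance Definition _ := Quotient.on Q.

Local Notation cls := (\pi_Q : G -> Q).

Lemma quotient_eqP (x y : G) : cls x = cls y <-> nsg_set H (x^-1 * y).
Proof.
have -> : (cls x = cls y) = (x = y %[mod {eq_quot coset_equiv H}]) by [].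
by split=> [/eqmodP/set_mem|/mem_set ?]; [|apply/eqmodP].
Qed.

Definition quotient_mul (a b : Q) : Q := cls (repr a * repr b).
Definition quotient_inv (a : Q) : Q := cls (repr a)^-1.

Lemma quotient_reprP (x : G) : nsg_set H ((repr (cls x))^-1 * x).
Proof. by apply/quotient_eqP; rewrite reprK. Qed.

Lemma quotient_mulE (x y : G) : quotient_mul (cls x) (cls y) = cls (x * y).
Proof.
apply/quotient_eqP.
have Hx := quotient_reprP x; have Hy := quotient_reprP y.
set x' := repr _ in Hx *; set y' := repr _ in Hy *.
have -> : (x' * y')^-1 * (x * y) = ((x'^-1 * x) ^ y') * (y'^-1 * y).
  by rewrite conjgE invgM !mulgA mulgK.
exact: nsgM (nsgJ _ Hx) Hy.
Qed.

Lemma quotient_invE (x : G) : quotient_inv (cls x) = cls x^-1.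
Proof.
apply/quotient_eqP; have := quotient_reprP x; set x' := repr _ => Hx.
have -> : x'^-1^-1 * x^-1 = ((x'^-1 * x)^-1) ^ x'^-1.
  by rewrite conjgE invgM !invgK !mulgA mulgK.
exact: nsgJ (nsgV Hx).
Qed.

Lemma quotient_ind (P : Q -> Prop) : (forall x, P (cls x)) -> forall a, P a.
Proof. by move=> Pcls a; rewrite -[a]reprK. Qed.

Lemma quotient_mulA : associative quotient_mul.
Proof.
elim/quotient_ind => x; elim/quotient_ind => y; elim/quotient_ind => z.
by rewrite !quotient_mulE mulgA.
Qed.

Lemma quotient_mul1 : left_id (cls 1) quotient_mul.
Proof. by elim/quotient_ind => x; rewrite quotient_mulE mul1g. Qed.

Lemma quotient_1mul : right_id (cls 1) quotient_mul.
Proof. by elim/quotient_ind => x; rewrite quotient_mulE mulg1. Qed.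

Lemma quotient_mulV : left_inverse (cls 1) quotient_inv quotient_mul.
Proof.
by elim/quotient_ind => x; rewrite quotient_invE quotient_mulE mulVg.
Qed.

Lemma quotient_Vmul : right_inverse (cls 1) quotient_inv quotient_mul.
Proof.
by elim/quotient_ind => x; rewrite quotient_invE quotient_mulE mulgV.
Qed.

HB.instance Definition _ := isGroup.Build Q
  quotient_mulA quotient_mul1 quotient_1mul quotient_mulV quotient_Vmul.

Lemma quotient_cls_continuous : continuous cls.
Proof. exact: pi_continuous. Qed.

Lemma quotient_cls_open (A : set G) : open A -> open (cls @` A).
Proof.
move=> oA; change (open (cls @^-1` (cls @` A))).
have -> : cls @^-1` (cls @` A) =
    \bigcup_(h in (H : set G)) ((fun x => x * h) @^-1` A).
  apply/seteqP; split=> [x [a Aa /esym/quotient_eqP Hxa]|x [h Hh Axh]].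
    by exists (x^-1 * a) => //=; rewrite mulgA mulgV mul1g.
  by exists (x * h) => //; apply/esym/quotient_eqP; rewrite mulgA mulVg mul1g.
apply: bigcup_open => h _; apply: open_comp => // x _.
have cid : continuous (id : G -> G) by move=> y; exact: cvg_id.
have ch : continuous (fun _ : G => h) by move=> ?; exact: cvg_cst.
exact: (continuous_mulg cid ch) x.
Qed.

Lemma quotient_mulg_continuous : continuous (fun ab : Q * Q => ab.1 * ab.2).
Proof.
move=> [a b]; elim/quotient_ind: a => x; elim/quotient_ind: b => y /=.
move=> W Wxy0; have Wxy : nbhs (cls (x * y)) W by rewrite -quotient_mulE.
have /(@mulg_continuous G (x, y)) : nbhs (x * y) (cls @^-1` W).
  exact: (@quotient_cls_continuous (x * y)) Wxy.
move=> [[A B] /= [nA nB] AB].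
move: nA nB; rewrite (nbhsE x) (nbhsE y).
move=> -[A' [oA' A'x] sA] [B' [oB' B'y] sB].
have nAB : nbhs (cls x, cls y) ((cls @` A') `*` (cls @` B')).
  exists (cls @` A', cls @` B') => //=.
  by split; apply: open_nbhs_nbhs; split;
    [exact: quotient_cls_open|exists x|exact: quotient_cls_open|exists y].
apply: filterS nAB.
move=> [_ _] [/= [u A'u <-] [v B'v <-]].
change (W (quotient_mul (cls u) (cls v))); rewrite quotient_mulE.
by apply: (AB (u, v)); split; [exact: sA|exact: sB].
Qed.

Lemma quotient_invg_continuous : continuous (fun a : Q => a^-1).
Proof.
apply/quotient_continuous => x.
have -> : (fun a : Q => a^-1) \o cls = cls \o (fun x => x^-1).
  by apply/funext => u; exact: quotient_invE.
apply: (@continuous_comp _ _ _ (fun x : G => x^-1) cls).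
  exact: invg_continuous.
exact: quotient_cls_continuous.
Qed.

HB.instance Definition _ := isTopologicalGroup.Build Q
  quotient_mulg_continuous quotient_invg_continuous.
End QuotientGroup.

Record flow (G : topologicalGroupType) := Flow {
  flow_space :> topologicalType;
  flow_act : G -> flow_space -> flow_space;
  flow_compact : compact [set: flow_space];
  flow_hausdorff : hausdorff_space flow_space;
  flow_regular : regular_space flow_space;
  flow_act1 : forall x, flow_act 1 x = x;
  flow_actM : forall g h x, flow_act (g * h) x = flow_act g (flow_act h x);
  flow_continuous :
    continuous (fun gx : G * flow_space => flow_act gx.1 gx.2)
}.

Section Flows.
Context (G : topologicalGroupType).

(* The empty flow is excluded: otherwise it would be minimal, and no flow would
   map onto both it and the one-point flow. *)
Definition minimal_flow (X : flow G) : Prop :=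
  [set: X] !=set0 /\ forall x : X, dense [set flow_act g x | g in [set: G]].

Definition flow_morphism (X Y : flow G) (f : X -> Y) : Prop :=
  continuous f /\ forall g x, f (flow_act g x) = flow_act g (f x).

Definition universal_minimal_flow (M : flow G) : Prop :=
  minimal_flow M /\
  forall Y : flow G, minimal_flow Y ->
    exists f : M -> Y, flow_morphism f /\ set_surj [set: M] [set: Y] f.

Definition symmetric_open_nbhs1 (U : set G) : Prop :=
  [/\ open U, U 1 & forall g, U g -> U g^-1].

Definition flow_translates (X : flow G) (U : set G) (B : set X) : set X :=
  [set flow_act g x | g in U & x in B].

Definition U_TT (X : flow G) (U : set G) (A : set X) : Prop :=
  [/\ open A, A !=set0 &
    forall B : set X, open B -> B !=set0 -> B `<=` A ->
      A `<=` closure (flow_translates U B)].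

Definition rosendal_criterion (X : flow G) : Prop :=
  forall U : set G, symmetric_open_nbhs1 U ->
  forall A : set X, open A -> A !=set0 ->
    exists B : set X, B `<=` A /\ U_TT U B.

(* The universal minimal flow exists and is unique up to isomorphism, and the
   Rosendal criterion is invariant under isomorphism. *)
Definition TMD : Prop :=
  exists M : flow G, universal_minimal_flow M /\ rosendal_criterion M.

End Flows.

Arguments TMD G : clear implicits.

(* Main.v *)
Require Import Defs.
From HB Require Import structures.
From mathcomp Require Import all_boot all_classical.
From mathcomp Require Import topology_structure compact separation_axioms.
From mathcomp Require Import initial_topology product_topology.
From mathcomp Require Import subtype_topology subspace_topology.
From mathcomp Require Import quotient_topology supremum_topology.
From mathcomp Require Import function_spaces.

(** The proof replaces the Rosendal criterion by a finitary property that can be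
    tested in every minimal flow. Call a minimal flow X linked by (U, F), where
    U is a neighbourhood of 1 and F a finite subset of the group, if for all
    points x, y and open V, W with F x contained in V and F y contained in W
    some element of U sends a point of V into W. A minimal flow satisfies the
    Rosendal criterion iff for every U it is linked by (U, F) for some F
    ([rosendal_linked], [linked_rosendal]). Linking passes to factors without
    changing F, so for a group in TMD one F serves all minimal flows
    ([TMD_linked]).

    Now let X be a minimal flow of G, let F_H be a finite set for H and a
    neighbourhood U0, and let F_K be one for G/H and the image of a smaller
    neighbourhood U1, whose conjugates by F_H lie in U0. The closed H-invariant
    subsets of X form a compact Hausdorff space in the Vietoris topology, on
    which G acts through G/H ([hyperspace_flow]). The translates g Y of an
    H-minimal set Y accumulate on a G/H-minimal set of this hyperspace. Linking
    there yields a translate g Y, again H-minimal, that comes close to V and,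
    up to an element of U1, close to W; linking inside g Y then joins V to W by
    an element of U0 U0. Hence X is linked by (U0 U0, F_H F_K), where F_K is
    lifted to G ([extension_linked]).

    It remains to know that a universal minimal flow of G exists
    ([universal_minimal_flow_exists]). A pointed minimal flow is determined by
    the proximity relation that its orbit map induces on the subsets of G, so
    up to isomorphism minimal flows form a set, and a minimal subset of the
    product of representatives is universal. *)

Set Implicit Arguments.
Unset Strict Implicit.
Unset Printing Implicit Defensive.

Local Open Scope classical_set_scope.
Local Open Scope group_scope.

#[local] Set SsrOldRewriteGoalsOrder.

Local Notation "g *> x" := (flow_act g x) (at level 40, left associativity).

(** * Topological preliminaries *)

Lemma filter_seqI (T : Type) (I : eqType) (F : set_system T) (s : seq I)
    (P : I -> set T) : Filter F ->
  (forall i, i \in s -> F (P i)) -> F [set x | forall i, i \in s -> P i x].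
Proof.
move=> FF; elim: s => [|i s IH] Ps; first exact: filterS filterT.
have Fs := IH (fun j js => Ps j (mem_behead (s := i :: s) js)).
apply: filterS (filterI (Ps i (mem_head i s)) Fs) => x [Pi Pj] j.
by rewrite inE => /orP[/eqP->|/Pj].
Qed.

Lemma open_seqI (T : topologicalType) (I : eqType) (s : seq I)
    (P : I -> set T) :
  (forall i, i \in s -> open (P i)) -> open [set x | forall i, i \in s -> P i x].
Proof.
move=> oP; rewrite openE => x Px; apply: filter_seqI => i si.
by apply: open_nbhs_nbhs; split; [exact: oP|exact: Px].
Qed.

(** Finite subcovers as sequences, for spaces that need not be pointed: if no
    finite subfamily covers, the complements of the finite subunions generate
    a proper filter, and a cluster point of it lies in no member. *)
Lemma compact_seq_cover (T : topologicalType) (I : eqType) (f : I -> set T) :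
  compact [set: T] -> (forall i, open (f i)) -> (forall x, exists i, f i x) ->
  exists s : seq I, forall x, exists2 i, i \in s & f i x.
Proof.
move=> cT of_ fcov; apply: contrapT => nos.
pose F := filter_from [set: seq I] (fun s => [set x | forall i, i \in s -> ~ f i x]).
have PF : ProperFilter F.
  apply: filter_from_proper.
    apply: filter_from_filter; first by exists [::].
    move=> s t _ _; exists (s ++ t) => // x st; split=> i si; apply: st.
      by rewrite mem_cat si.
    by rewrite mem_cat si orbT.
  move=> s _; apply: contrapT => sx; apply: nos; exists s => x.
  apply: contrapT => nx; apply: sx; exists x => i si fix_.
  by apply: nx; exists i.
have [x [_ xF]] := cT F PF filterT.
have [i fix_] := fcov x.
have Fi : F (~` f i).
  by exists [:: i] => // y /(_ i); apply; rewrite mem_head.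
by have [y [? ?]] := xF _ _ Fi (open_nbhs_nbhs (conj (of_ i) fix_)).
Qed.

(** * Symmetric neighbourhoods of the identity *)

Section GroupNeighbourhoods.
Context (G : topologicalGroupType).
Implicit Types (U W : set G).

Lemma nbhs1_symmetric (N : set G) : nbhs 1 N ->
  exists2 U, symmetric_open_nbhs1 U & U `<=` N.
Proof.
rewrite nbhsE => -[O [oO O1] ON].
exists (O `&` (fun x => x^-1) @^-1` O); last by move=> x [/ON].
split.
- by apply: openI => //; apply: open_comp => // x _; exact: invg_continuous.
- by split=> //=; rewrite invg1.
- by move=> g [Og OVg]; split=> //=; rewrite invgK.
Qed.

Lemma symmetric_sqrt U : symmetric_open_nbhs1 U ->
  exists2 W, symmetric_open_nbhs1 W & forall v w, W v -> W w -> U (v * w).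
Proof.
move=> [oU U1 _].
have : nbhs ((1, 1) : G * G) (fun xy => U (xy.1 * xy.2)).
  apply: (@mulg_continuous G (1, 1)) => /=; rewrite mulg1.
  exact: open_nbhs_nbhs.
move=> [[A B] /= [A1 B1] AB].
have [W sW WAB] := nbhs1_symmetric (filterI A1 B1).
exists W => // v w Wv Ww; apply: (AB (v, w)); split=> /=.
  by have [] := WAB _ Wv.
by have [] := WAB _ Ww.
Qed.

Lemma symmetric_conj U (s : seq G) : symmetric_open_nbhs1 U ->
  exists2 W, symmetric_open_nbhs1 W &
    forall f w, f \in s -> W w -> U (f * w * f^-1).
Proof.
move=> [oU U1 _].
have [|W sW Ws] := @nbhs1_symmetric [set w | forall f, f \in s -> U (f * w * f^-1)].
  apply: filter_seqI => f _.
  have cf : continuous (fun w : G => f * w * f^-1).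
    apply: continuous_mulg; last by move=> ?; exact: cvg_cst.
    by apply: continuous_mulg => [?|?]; [exact: cvg_cst|exact: cvg_id].
  by apply: (cf 1); rewrite mulg1 mulgV; exact: open_nbhs_nbhs.
by exists W => // f w sf Ww; exact: Ws.
Qed.

End GroupNeighbourhoods.

(** * Invariant and minimal subsets of a flow *)

Section FlowBasics.
Context (G : topologicalGroupType) (X : flow G).
Implicit Types (x y : X) (A : set X).

Lemma flow_actK g x : g^-1 *> (g *> x) = x.
Proof. by rewrite -flow_actM mulVg flow_act1. Qed.

Lemma flow_actVK g x : g *> (g^-1 *> x) = x.
Proof. by rewrite -flow_actM mulgV flow_act1. Qed.

Lemma flow_act_continuous g : continuous (flow_act g : X -> X).
Proof.
move=> x N Nx.
have [[A B] /= [A1 Bx] AB] := @flow_continuous G X (g, x) N Nx.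
by apply: filterS Bx => y By; apply: (AB (g, y)); split=> //; exact: nbhs_singleton A1.
Qed.

Lemma open_act g A : open A -> open [set x | A (g *> x)].
Proof. by move=> oA; apply: open_comp => // x _; exact: flow_act_continuous. Qed.

Lemma closed_act g A : closed A -> closed [set x | A (g *> x)].
Proof.
by move=> cA; apply: preimage_closed => // x _; exact: flow_act_continuous.
Qed.

Definition flow_orbit x : set X := [set g *> x | g in [set: G]].

Definition invariant_set A := forall g x, A x -> A (g *> x).

(** Minimality is stated for subsets of an ambient flow, so that the orbit
    closures met below can be compared inside one space. *)
Definition minimal_set A :=
  [/\ closed A, A !=set0, invariant_set A &
    forall x, A x -> A `<=` closure (flow_orbit x)].

Lemma minimal_setP A x (B : set X) : minimal_set A -> A x -> open B -> A `&` B !=set0 ->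
  exists g, B (g *> x).
Proof.
move=> [_ _ _ mA] Ax oB [y [Ay By]].
have [_ [[g _ <-] ?]] := mA x Ax y Ay B (open_nbhs_nbhs (conj oB By)).
by exists g.
Qed.

Lemma minimal_flow_setT : minimal_flow X -> minimal_set [set: X].
Proof.
move=> [n0 dX]; split=> // x _ y _ B; rewrite nbhsE => -[O [oO Oy] OB].
have [z [Oz xz]] := dX x O (ex_intro _ y Oy) oO.
by exists z; split=> //; exact: OB.
Qed.

Lemma closure_act g A x : closure A x -> closure [set g *> y | y in A] (g *> x).
Proof.
move=> clx N Nx.
have [y [Ay Ny]] := clx _ (@flow_act_continuous g x N Nx).
by exists (g *> y); split=> //; exists y.
Qed.

Lemma closure_invariant A : invariant_set A -> invariant_set (closure A).
Proof.
move=> iA g x clx.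
have gA : [set g *> y | y in A] `<=` A by move=> _ [y Ay <-]; exact: iA.
by apply: (closureS gA); exact: closure_act.
Qed.

Lemma flow_orbit_invariant x : invariant_set (flow_orbit x).
Proof. by move=> g _ [h _ <-]; exists (g * h) => //; rewrite flow_actM. Qed.

Lemma flow_orbit_refl x : flow_orbit x x.
Proof. by exists 1 => //; rewrite flow_act1. Qed.

(** Zorn's lemma for reverse inclusion: a chain of nonempty closed invariant
    sets is a filter base, and compactness makes its intersection nonempty. A
    member that is minimal for inclusion is contained in the orbit closure of
    each of its points, as that closure is itself a competitor. *)
Lemma minimal_set_exists A : closed A -> invariant_set A -> A !=set0 ->
  exists2 B, B `<=` A & minimal_set B.
Proof.
move=> cA iA [a Aa].
pose P (B : set X) := [/\ B `<=` A, closed B, invariant_set B & B !=set0].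
pose S := {B : set X | P B}.
pose A0 : S := exist P A (And4 (fun _ h => h) cA iA (ex_intro _ a Aa)).
pose R (B C : S) := `[< sval C `<=` sval B >].
have [B|B C D|C totC|[B [BA cB iB nB]] Bmax] := @ZL_preorder S A0 R.
- exact/asboolP.
- by move=> /asboolP BC /asboolP CD; apply/asboolP => x /CD/BC.
  (* The empty chain is bounded by A itself. *)
- have [[C0 CC0]|noC] := pselect (exists C0, C C0); last first.
    by exists A0 => s Cs; case: noC; exists s.
  pose F := filter_from C (fun B : S => sval B).
  have PF : ProperFilter F.
    apply: filter_from_proper; last by move=> B _; have [] := svalP B.
    apply: filter_from_filter; first by exists C0.
    move=> B D CB CD; have [/asboolP BD|/asboolP DB] := totC _ _ CB CD.
      by exists D => // x Dx; split=> //; exact: BD.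
    by exists B => // x Bx; split=> //; exact: DB.
  have [x [_ xF]] := @flow_compact G X F PF filterT.
  have xC B : C B -> sval B x.
    move=> CB; have [_ cB _ _] := svalP B; apply: cB => N Nx.
    by apply: xF Nx; exists B.
  have PI : P (\bigcap_(B in C) sval B).
    split.
    - by move=> y /(_ _ CC0); have [+ _ _ _] := svalP C0; apply.
    - by apply: closed_bigI => B _; have [] := svalP B.
    - move=> g y yC B CB; have [_ _ iB _] := svalP B; exact/iB/yC.
    - by exists x.
  by exists (exist P _ PI) => B CB; apply/asboolP => y /(_ _ CB).
- exists B => //; split=> // x Bx.
  have OB : closure (flow_orbit x) `<=` B.
    by apply: subset_trans (cB); apply: closureS => _ [g _ <-]; exact: (iB).
  have PO : P (closure (flow_orbit x)).
    split; [exact: subset_trans OB (BA)|exact: closed_closure| |].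
      exact/closure_invariant/flow_orbit_invariant.
    by exists x; apply: subset_closure; exact: flow_orbit_refl.
  by have /asboolP := Bmax (exist P _ PO) (asboolT OB).
Qed.

End FlowBasics.

(** * Subflows and products of flows *)

Lemma compact_hausdorff_regular (T : topologicalType) :
  compact [set: T] -> hausdorff_space T -> regular_space T.
Proof. by move=> cT hT x; apply: (compact_regular hT cT); exact: filterT. Qed.

Lemma compact_set_type (T : topologicalType) (A : set T) :
  compact A -> compact [set: set_type A].
Proof.
move=> cA F PF _.
have [|p [Ap pF]] := cA (set_val @ F) _.
  apply: (@filterS _ F _ [set: set_type A]); last exact: filterT.
  by move=> x _; exact: set_mem (valP x).
exists (exist _ p (mem_set Ap)); split=> // B N FB.
move=> [_ [[O oO <-] Op ON]].
have FvB : (set_val @ F) (set_val @` B).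
  by apply: (@filterS _ F _ B) => // x Bx; exists x.
have [_ [[x Bx <-] Ox]] := pF _ O FvB (open_nbhs_nbhs (conj oO Op)).
by exists x; split=> //; exact: ON.
Qed.

Lemma hausdorff_set_type (T : topologicalType) (A : set T) :
  hausdorff_space T -> hausdorff_space (set_type A).
Proof.
move=> hT x y xy; apply: val_inj; apply: hT => B C Bx Cy.
have [z [Bz Cz]] := xy _ _ (@initial_continuous (set_type A) T set_val x B Bx)
  (@initial_continuous (set_type A) T set_val y C Cy).
by exists (set_val z).
Qed.

Section Subflow.
Context (G : topologicalGroupType) (X : flow G) (A : set X).
Hypotheses (cA : closed A) (iA : invariant_set A).

Definition subflow_act (g : G) (x : set_type A) : set_type A :=
  exist _ (g *> set_val x) (mem_set (iA g (set_mem (valP x)))).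

Lemma subflow_compact : compact [set: set_type A].
Proof.
apply: compact_set_type; exact: subclosed_compact cA (@flow_compact _ X) _.
Qed.

Lemma subflow_hausdorff : hausdorff_space (set_type A).
Proof. exact: hausdorff_set_type (@flow_hausdorff _ X). Qed.

Lemma subflow_act1 x : subflow_act 1 x = x.
Proof. by apply: val_inj; exact: flow_act1. Qed.

Lemma subflow_actM g h x : subflow_act (g * h) x = subflow_act g (subflow_act h x).
Proof. by apply: val_inj; exact: flow_actM. Qed.

Lemma subflow_continuous :
  continuous (fun gx : G * set_type A => subflow_act gx.1 gx.2).
Proof.
move=> [g x] N [_ [[O oO <-] Op ON]].
have [[B C] /= [Bg Cx] BC] := @flow_continuous _ X (g, set_val x) O
  (open_nbhs_nbhs (conj oO Op)).
exists (B, set_val @^-1` C) => /=.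
  by split=> //; exact: (@initial_continuous (set_type A) X set_val x C Cx).
by move=> [h y] /= [Bh Cy]; apply: ON; exact: (BC (h, set_val y)).
Qed.

Definition subflow : flow G := Flow subflow_compact subflow_hausdorff
  (compact_hausdorff_regular subflow_compact subflow_hausdorff)
  subflow_act1 subflow_actM subflow_continuous.

End Subflow.

Lemma subflow_minimal (G : topologicalGroupType) (X : flow G) (A : set X)
    (cA : closed A) (iA : invariant_set A) :
  minimal_set A -> minimal_flow (subflow cA iA).
Proof.
move=> mA; split.
  by have [_ [x Ax] _ _] := mA; exists (exist _ x (mem_set Ax)).
move=> x O [y Oy] [B oB BO]; move: Oy; rewrite -BO => By.
have [|g Bg] := minimal_setP mA (set_mem (valP x)) oB _.
  by exists (set_val y); split=> //; exact: set_mem (valP y).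
by exists (flow_act g x); split=> //; exists g.
Qed.

Section ProductFlow.
Context (G : topologicalGroupType) (J : eqType) (X : J -> flow G).
Local Notation P := (prod_topology (fun j => X j : topologicalType)).

Lemma prod_topology_cvg (F : set_system P) (x : P) : Filter F ->
  (forall j, (fun f : P => f j) @ F --> x j) -> F --> x.
Proof.
move=> FF Fx; apply/cvg_sup => j N [_ [[O oO <-] Ox ON]].
by apply: filterS ON _; exact: (Fx j O (open_nbhs_nbhs (conj oO Ox))).
Qed.

Lemma prod_coord_continuous j : continuous (fun f : P => f j).
Proof. exact: (@proj_continuous J (fun j => X j : topologicalType) j). Qed.

Definition prod_flow_act (g : G) (x : P) : P := fun j => g *> x j.

Lemma prod_flow_compact : compact [set: P].
Proof.
have /tychonoff := fun j => @flow_compact G (X j).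
by rewrite (_ : [set f | _] = setT) //; apply/seteqP; split.
Qed.

Lemma prod_flow_hausdorff : hausdorff_space P.
Proof. by apply: hausdorff_product => j; exact: flow_hausdorff. Qed.

Lemma prod_flow_act1 x : prod_flow_act 1 x = x.
Proof. by apply: functional_extensionality_dep => j; exact: flow_act1. Qed.

Lemma prod_flow_actM g h x :
  prod_flow_act (g * h) x = prod_flow_act g (prod_flow_act h x).
Proof. by apply: functional_extensionality_dep => j; exact: flow_actM. Qed.

Lemma prod_flow_continuous :
  continuous (fun gx : G * P => prod_flow_act gx.1 gx.2).
Proof.
move=> [g x]; apply: prod_topology_cvg => j N Nx.
have [[B C] /= [Bg Cx] BC] := @flow_continuous _ (X j) (g, x j) N Nx.
exists (B, (fun f : P => f j) @^-1` C) => /=.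
  by split=> //; exact: prod_coord_continuous.
by move=> [h y] /= [Bh Cy]; exact: (BC (h, y j)).
Qed.

Definition prod_flow : flow G := Flow prod_flow_compact prod_flow_hausdorff
  (compact_hausdorff_regular prod_flow_compact prod_flow_hausdorff)
  prod_flow_act1 prod_flow_actM prod_flow_continuous.

End ProductFlow.

(** * Existence of the universal minimal flow *)

Section UniversalMinimalFlow.
Context (G : topologicalGroupType).

(** A compactification is determined by the proximity relation it induces on
    the subsets of the space, and a minimal flow with base point z is a
    (possibly non-injective) compactification of G by means of g |-> g z.
    Hence this relation, which lives on the subsets of G alone, determines a
    minimal flow Z with base point z up to isomorphism. *)
Definition orbit_proximity (Z : flow G) (z : Z) (A B : set G) : Prop :=
  closure [set g *> z | g in A] `&` closure [set g *> z | g in B] !=set0.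

Section ProximityMorphism.
Context (Y Z : flow G) (y0 : Y) (z0 : Z).
Hypothesis minY : minimal_flow Y.
Hypothesis proxYZ :
  forall A B, orbit_proximity y0 A B -> orbit_proximity z0 A B.

(** The morphism to be built maps g y0 to g z0. Its value at y is the limit of
    the sets of all g z0 such that g y0 lies in a given neighbourhood of y. *)
Definition orbit_trace (O : set Y) : set Z := [set g *> z0 | g in [set g | O (g *> y0)]].

Definition orbit_trace_filter (y : Y) : set_system Z := filter_from (nbhs y) orbit_trace.

Lemma orbit_trace_filter_proper y : ProperFilter (orbit_trace_filter y).
Proof.
have [_ dY] := minY.
apply: filter_from_proper.
  apply: filter_from_filter; first by exists setT; exact: filterT.
  move=> O O' yO yO'; exists (O `&` O'); first exact: filterI.
  by move=> _ [g [Og O'g] <-]; split; exists g.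
move=> N; rewrite nbhsE => -[O [oO Oy] ON].
have [w [Ow [g _ gw]]] := dY y0 O (ex_intro _ y Oy) oO.
by exists (g *> z0); exists g => //; apply: ON; rewrite gw.
Qed.

(** Two cluster points would have neighbourhoods with disjoint closures; the
    sets of group elements sending z0 into them are then not proximal for z0,
    although the orbit points of y0 they select both accumulate at y. *)
Lemma orbit_trace_cluster_unique y z z' :
  cluster (orbit_trace_filter y) z -> cluster (orbit_trace_filter y) z' -> z = z'.
Proof.
move=> yz yz'; apply: contrapT => zz'.
have := @flow_hausdorff _ Z; rewrite open_hausdorff => /(_ z z').
move=> /(_ (introN eqP zz')) [[O O'] /= [/set_mem Oz /set_mem O'z'] [oO oO' OO']].
have [N zN NO] := @flow_regular _ Z z O (open_nbhs_nbhs (conj oO Oz)).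
have [N' zN' NO'] := @flow_regular _ Z z' O' (open_nbhs_nbhs (conj oO' O'z')).
pose A := [set g | N (g *> z0)]; pose A' := [set g | N' (g *> z0)].
have yA (M : set Z) w : nbhs w M -> cluster (orbit_trace_filter y) w ->
    closure [set g *> y0 | g in [set g | M (g *> z0)]] y.
  move=> wM yw B By; have [|_ [[g Bg <-] Mg]] := yw (orbit_trace B) M _ wM.
    by exists B.
  by exists (g *> y0); split=> //; exists g.
have [w [Aw A'w]] : orbit_proximity z0 A A'.
  by apply: proxYZ; exists y; split; [exact: yA zN yz|exact: yA zN' yz'].
have Ow : O w.
  by apply: NO; apply: closureS Aw => _ [g Ng <-].
have O'w : O' w.
  by apply: NO'; apply: closureS A'w => _ [g Ng <-].
by have : set0 w by rewrite -(eqP OO').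
Qed.

(** By compactness and uniqueness of the cluster point the filter converges,
    which gives both the map and its continuity. *)
Lemma proximity_morphism : exists f : Y -> Z, flow_morphism f.
Proof.
have ex y : exists z, cluster (orbit_trace_filter y) z.
  have PF := orbit_trace_filter_proper y.
  by have [z [_ yz]] := @flow_compact _ Z (orbit_trace_filter y) PF filterT; exists z.
have [f fP] := choice ex.
have fE y z : cluster (orbit_trace_filter y) z -> f y = z.
  by move=> yz; exact: orbit_trace_cluster_unique (fP y) yz.
have fcvg y : orbit_trace_filter y --> f y.
  apply: (compact_cluster_set1 (@flow_hausdorff _ Z) (@flow_compact _ Z)).
  - exact: filterT.
  - exact: orbit_trace_filter_proper.
  - by exists setT => //; exact: filterT.
  - by apply/seteqP; split=> [z /fE|_ ->].
exists f; split.
  move=> y N /(@flow_regular _ Z) [M yM MN].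
  have [O yO OM] := fcvg y M yM.
  apply: filterS (nbhs_interior yO) => w wO; apply: MN => K wK.
  have [|z [Oz Kz]] := fP w (orbit_trace O) K _ wK; first by exists O.
  by exists z; split=> //; exact: OM.
move=> h y; apply: fE => S N [O yO OS] zN.
have [|_ [[g Og <-] Ng]] := fP y (orbit_trace [set w | O (h *> w)])
    [set z | N (h *> z)] _ (@flow_act_continuous _ Z h _ N zN).
  by exists [set w | O (h *> w)] => //; exact: (@flow_act_continuous _ Y h _ O yO).
exists (h *> (g *> z0)); split=> //; apply: OS.
by exists (h * g); rewrite ?flow_actM //= flow_actM.
Qed.

End ProximityMorphism.

(** The image is a closed set containing a dense orbit. *)
Lemma morphism_minimal_surj (Y Z : flow G) (f : Y -> Z) :
  minimal_flow Y -> minimal_flow Z -> flow_morphism f ->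
  set_surj [set: Y] [set: Z] f.
Proof.
move=> [[y _] _] [_ dZ] [cf ef].
have cY : compact (f @` [set: Y]).
  apply: continuous_compact (@flow_compact _ Y).
  by apply: continuous_subspaceT.
have clY := compact_closed (@flow_hausdorff _ Z) cY.
move=> z _; apply: clY => N; rewrite nbhsE => -[O [oO Oz] ON].
have [w [Ow [g _ gw]]] := dZ (f y) O (ex_intro _ z Oz) oO.
exists (f (g *> y)); split; first by exists (g *> y).
by apply: ON; rewrite ef gw.
Qed.

(** Minimal flows form a proper class, but their proximity relations form a
    set. Choose a pointed minimal flow for each relation that occurs and take
    a minimal subset of the product of these flows: every minimal flow is an
    image of one of the chosen factors, hence of the minimal subset. *)
Lemma universal_minimal_flow_exists : exists M : flow G, universal_minimal_flow M.
Proof.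
pose J := {c : set G -> set G -> Prop |
  exists (Z : flow G) (z : Z), minimal_flow Z /\ c = orbit_proximity z}.
have rep (j : J) : {Zz : {Z : flow G & Z} |
    minimal_flow (tag Zz) /\ sval j = orbit_proximity (tagged Zz)}.
  apply: cid; have [Z [z [mZ jE]]] := svalP j.
  by exists (existT _ Z z).
pose X (j : {classic J}) := tag (sval (rep j)).
pose x0 : prod_flow X := fun j => tagged (sval (rep j)).
have [||M _ mM] := @minimal_set_exists G (prod_flow X) setT closedT.
- by [].
- by exists x0.
have [cM _ iM _] := mM; have mF := subflow_minimal cM iM mM.
exists (subflow cM iM); split=> // Z mZ; have [[z _] _] := mZ.
have exj : exists (Y : flow G) (y : Y),
  minimal_flow Y /\ orbit_proximity z = orbit_proximity y by exists Z, z.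
pose j : J := exist _ (orbit_proximity z) exj.
have [mY jE] := svalP (rep j).
have [|f [cf ef]] := @proximity_morphism _ Z (tagged (sval (rep j))) z mY.
  by move=> A B; rewrite -jE.
suff fm : flow_morphism (fun x : subflow cM iM => f (set_val x j)).
  by exists (fun x : subflow cM iM => f (set_val x j)); split=> //;
    exact: morphism_minimal_surj.
split; last by move=> g x; exact: ef.
move=> x; apply: (@continuous_comp _ _ _ (fun x : subflow cM iM => set_val x j) f).
  apply: (@continuous_comp _ _ _ (set_val : subflow cM iM -> prod_flow X)
    (fun x : prod_flow X => x j)); first exact: initial_continuous.
  exact: prod_coord_continuous.
exact: cf.
Qed.

End UniversalMinimalFlow.

(** * The Rosendal criterion as a uniform linking property *)

(** A finitary substitute for the Rosendal criterion: it passes to factors with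
    the same F, so one F can serve all minimal sets of all flows. *)
Definition linked (G : topologicalGroupType) (X : flow G) (U : set G)
    (F : seq G) (A : set X) : Prop :=
  forall (x y : X) (V W : set X), A x -> A y -> open V -> open W ->
    (forall f, f \in F -> V (f *> x)) -> (forall f, f \in F -> W (f *> y)) ->
    exists u v, [/\ U u, A v, V v & W (u *> v)].

(** Take a U-TT set B and a finite F such that every point is sent into B by an
    element of F. Both V and W then meet B, and V meeting B is enough for the
    U-translates of the intersection to be dense in B. *)
Lemma rosendal_linked (G : topologicalGroupType) (M : flow G) (U : set G) :
  minimal_flow M -> rosendal_criterion M -> symmetric_open_nbhs1 U ->
  exists F, linked U F [set: M].
Proof.
move=> mM rM sU; have [n0 _] := mM.
have [B [_ [oB [b Bb] BTT]]] := rM U sU _ openT n0.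
have mMs := minimal_flow_setT mM.
have [|F FB] := @compact_seq_cover M G (fun g => [set x | B (g *> x)])
    (@flow_compact _ M) (fun g => @open_act _ _ g _ oB).
  by move=> x; apply: (minimal_setP mMs) => //; exists b.
exists F => x y V W _ _ oV oW FV FW.
have [f sf Bfx] := FB x; have [f' sf' Bfy] := FB y.
have [|_ [[u Uu [v [Bv Vv] <-]] Wuv]] := BTT (B `&` V) (openI oB oV) _
    (@subIsetl _ _ _) _ Bfy W (open_nbhs_nbhs (conj oW (FW _ sf'))).
  by exists (f *> x); split=> //; exact: FV.
by exists u, v.
Qed.

Lemma linked_image (G : topologicalGroupType) (M X : flow G) (phi : M -> X)
    (U : set G) (F : seq G) (A : set X) :
  flow_morphism phi -> (forall x, A (phi x)) -> (forall x, A x -> exists m, phi m = x) ->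
  linked U F [set: M] -> linked U F A.
Proof.
move=> [cphi ephi] phiA surj MF x y V W Ax Ay oV oW FV FW.
have [m mx] := surj x Ax; have [n ny] := surj y Ay.
have oP (O : set X) : open O -> open (phi @^-1` O).
  by move=> oO; apply: open_comp => // z _; exact: cphi.
have [||u [v [Uu _ Vv Wuv]]] := MF m n _ _ I I (oP V oV) (oP W oW).
- by move=> f sf /=; rewrite ephi mx; exact: FV.
- by move=> f sf /=; rewrite ephi ny; exact: FW.
by exists u, (phi v); rewrite -ephi.
Qed.

(** Each minimal set is a factor of the universal minimal flow, and inherits
    the F found there. *)
Lemma TMD_linked (G : topologicalGroupType) (U : set G) :
  TMD G -> symmetric_open_nbhs1 U ->
  exists F, forall (X : flow G) (A : set X), minimal_set A -> linked U F A.
Proof.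
move=> [M [[mM uM] rM]] sU; have [F MF] := rosendal_linked mM rM sU.
exists F => X A mA; have [cA _ iA _] := mA.
have [phi [[cphi ephi] surj]] := uM _ (subflow_minimal cA iA mA).
apply: (@linked_image _ M X (fun m => set_val (phi m))) MF.
- split; last by move=> g m; rewrite ephi.
  move=> m; apply: (@continuous_comp _ _ _ phi set_val); first exact: cphi.
  exact: initial_continuous.
- by move=> m; exact: set_mem (valP (phi m)).
- move=> x Ax; have [m _ mx] := surj (exist _ x (mem_set Ax)) I.
  by exists m; rewrite mx.
Qed.

Section LinkedRosendal.
Context (G : topologicalGroupType) (X : flow G).
Implicit Types (U W : set G) (P Q : set X).

Lemma open_translates U P : open P -> open (flow_translates U P).
Proof.
move=> oP; have -> : flow_translates U P = \bigcup_(u in U) [set x | P (u^-1 *> x)].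
  apply/seteqP; split=> [_ [u Uu [x Px <-]]|x [u Uu Px]].
    by exists u => //=; rewrite flow_actK.
  by exists u => //; exists (u^-1 *> x) => //; rewrite flow_actVK.
by apply: bigcup_open => u _; exact: open_act.
Qed.

Definition separated W P Q := forall w x, W w -> P x -> ~ Q (w *> x).

Lemma separated_sub W P P' Q Q' : P' `<=` P -> Q' `<=` Q ->
  separated W P Q -> separated W P' Q'.
Proof. by move=> PP QQ sPQ w x Ww /PP Px /QQ; exact: sPQ. Qed.

Section NoTT.
Context (U W : set G).
Hypotheses (sW : symmetric_open_nbhs1 W)
  (WU : forall v w, W v -> W w -> U (v * w))
  (noTT : forall B : set X, ~ U_TT U B).

(** As Q is not U-TT, it contains an open Q1 and an open piece that no element
    of U reaches from Q1. If W moves a point of P into Q1, restrict P to points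
    sent into Q1 by one fixed element of W: since W W is contained in U, W
    cannot send them into that piece. Otherwise P and Q1 are separated
    already. *)
Lemma shrink_separated P Q : open P -> P !=set0 -> open Q -> Q !=set0 ->
  exists P' Q', [/\ open P', P' !=set0 & P' `<=` P] /\
    [/\ open Q', Q' !=set0, Q' `<=` Q & separated W P' Q'].
Proof.
move=> oP nP oQ nQ; have [_ _ WV] := sW.
have [Q1 [oQ1 nQ1 Q1Q [q [Qq Q1q]]]] : exists Q1 : set X,
    [/\ open Q1, Q1 !=set0, Q1 `<=` Q &
      exists q, Q q /\ ~ closure (flow_translates U Q1) q].
  apply: contrapT => no; apply: (noTT (B := Q)); split=> // B oB nB BQ x Qx.
  by apply: contrapT => Bx; apply: no; exists B; split=> //; exists x.
have [[w [p [Ww Pp Q1wp]]]|nowp] := pselect (exists w p, [/\ W w, P p & Q1 (w *> p)]).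
  exists (P `&` [set x | Q1 (w *> x)]), (Q `&` ~` closure (flow_translates U Q1)).
  split; split.
  - by apply: openI => //; exact: open_act.
  - by exists p.
  - exact: subIsetl.
  - by apply: openI => //; apply: closed_openC; exact: closed_closure.
  - by exists q.
  - exact: subIsetl.
  - move=> v x Wv [_ Q1wx] [_]; apply; apply: subset_closure.
    exists (v * w^-1); first by apply: WU => //; exact: WV.
    by exists (w *> x) => //; rewrite flow_actM flow_actK.
exists P, Q1; split; split=> // v x Wv Px Q1vx; apply: nowp.
by exists v, x.
Qed.

(** Shrinking preserves separation, so finitely many pairs of translates can be
    treated one after the other. *)
Lemma shrink_separated_seq (s : seq (G * G)) :
  [set: X] !=set0 -> exists P Q, [/\ open P, P !=set0, open Q & Q !=set0] /\
    forall fg, fg \in s -> separated W [set fg.1 *> x | x in P] [set fg.2 *> x | x in Q].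
Proof.
move=> n0; elim: s => [|[f g] s [P [Q [[oP nP oQ nQ] sPQ]]]].
  by exists setT, setT; split=> //; split=> //; exact: openT.
have oT h (O : set X) : open O -> open [set x | O (h^-1 *> x)] by exact: open_act.
have nT h (O : set X) : O !=set0 -> [set x | O (h^-1 *> x)] !=set0.
  by move=> [x Ox]; exists (h *> x) => /=; rewrite flow_actK.
have [P' [Q' [[oP' [p P'p] P'P] [oQ' [q Q'q] Q'Q sPQ']]]] :=
  shrink_separated (oT f P oP) (nT f P nP) (oT g Q oQ) (nT g Q nQ).
exists [set x | P' (f *> x)], [set x | Q' (g *> x)]; split.
  split; [exact: open_act| |exact: open_act|].
    by exists (f^-1 *> p) => /=; rewrite flow_actVK.
  by exists (g^-1 *> q) => /=; rewrite flow_actVK.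
move=> fg; rewrite inE => /orP[/eqP->|sfg] /=.
  by apply: separated_sub sPQ' => _ [x + <-].
apply: separated_sub (sPQ _ sfg) => _ [x + <-].
  by move=> /P'P /=; rewrite flow_actK => Px; exists x.
by move=> /Q'Q /=; rewrite flow_actK => Qx; exists x.
Qed.

(** Separate the translates of P and Q for all pairs from F: the unions of the
    F-translates of P and of Q then contradict linking. *)
Lemma noTT_unlinked F : [set: X] !=set0 -> ~ linked W F [set: X].
Proof.
move=> n0 lF.
have [P [Q [[oP [x Px] oQ [y Qy]] sPQ]]] :=
  shrink_separated_seq [seq (f, g) | f <- F, g <- F] n0.
pose hull (O : set X) := \bigcup_(f in [set f | f \in F]) [set z | O (f^-1 *> z)].
have ohull O : open O -> open (hull O).
  by move=> oO; apply: bigcup_open => f _; exact: open_act.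
have hullP O z f : O z -> f \in F -> hull O (f *> z).
  by move=> Oz sf; exists f => //=; rewrite flow_actK.
have [u [v [Wu _ [f sf Pv] [g sg Quv]]]] := lF x y _ _ I I (ohull P oP) (ohull Q oQ)
  (fun f => hullP P x f Px) (fun f => hullP Q y f Qy).
have /sPQ : (f, g) \in [seq (f, g) | f <- F, g <- F] by apply: allpairs_f.
move=> /(_ u v Wu); apply => /=.
  by exists (f^-1 *> v) => //; rewrite flow_actVK.
by exists (g^-1 *> (u *> v)) => //; rewrite flow_actVK.
Qed.

End NoTT.

(** The open set D produced by noTT_unlinked may be far from A. Finitely many
    translates of A cover X, so one of them meets D; translating back
    conjugates the neighbourhood, whence the initial choice of U'. *)
Lemma linked_rosendal : minimal_flow X ->
  (forall U, symmetric_open_nbhs1 U -> exists F, linked U F [set: X]) ->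
  rosendal_criterion X.
Proof.
move=> mX lX U sU A oA [a Aa]; have [n0 _] := mX.
have mXs := minimal_flow_setT mX.
have [|s sA] := @compact_seq_cover X G (fun g => [set x | A (g *> x)])
    (@flow_compact _ X) (fun g => @open_act _ _ g _ oA).
  by move=> x; apply: (minimal_setP mXs) => //; exists a.
have [U' sU' U'U] := symmetric_conj s sU.
have [W sW WU'] := symmetric_sqrt sU'.
have [F lF] := lX W sW.
have [D [oD [d Dd] TTD]] : exists D : set X, U_TT U' D.
  apply: contrapT => noD; apply: (noTT_unlinked sW WU' _ n0 lF) => B TTB.
  by apply: noD; exists B.
have [g sg Agd] := sA d.
exists (A `&` [set x | D (g^-1 *> x)]); split; first exact: subIsetl.
split.
- by apply: openI => //; exact: open_act.
- by exists (g *> d); split=> //=; rewrite flow_actK.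
move=> B oB [b Bb] BA x [_ Dx] N Nx.
have cl : closure (flow_translates U' [set y | B (g *> y)]) (g^-1 *> x).
  apply: TTD => //; first exact: open_act.
    by exists (g^-1 *> b) => /=; rewrite flow_actVK.
  by move=> y /BA[_] /=; rewrite flow_actK.
have [|_ [[u U'u [y By <-]] Nguy]] := cl [set y | N (g *> y)].
  by apply: flow_act_continuous; rewrite flow_actVK.
exists (g *> (u *> y)); split=> //.
exists (g * u * g^-1); first exact: U'U.
by exists (g *> y) => //; rewrite !flow_actM flow_actK.
Qed.

End LinkedRosendal.

(** * The hyperspace of closed H-invariant subsets *)

Section InvariantHyperspace.
Context (G : topologicalGroupType) (H : normalSubgroup G) (X : flow G).

Record hyperspace := Hyperspace {
  hset :> set X;
  hset_closed : closed hset;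
  hset_invariant : forall h x, nsg_set H h -> hset x -> hset (h *> x)
}.

Implicit Types C D : hyperspace.

Lemma hyperspace_inj C D : hset C = hset D -> C = D.
Proof.
case: C D => [C cC iC] [D cD iD] /= CD; case: D / CD cD iD => cD iD.
by congr Hyperspace; exact: Prop_irrelevance.
Qed.

(** The closure under finite intersections of the usual subbase of the Vietoris
    topology; the inductive form lets convergence be checked on the subbase by
    induction. *)
Inductive vietoris_base : set hyperspace -> Prop :=
| vietoris_baseT : vietoris_base setT
| vietoris_base_sub W : open W -> vietoris_base [set C | C `<=` W]
| vietoris_base_meet V : open V -> vietoris_base [set C | C `&` V !=set0]
| vietoris_baseI P Q : vietoris_base P -> vietoris_base Q ->
    vietoris_base (P `&` Q).

Definition vietoris_open (O : set hyperspace) : Prop :=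
  forall C, O C -> exists2 B, vietoris_base B & B C /\ B `<=` O.

Lemma vietoris_openT : vietoris_open setT.
Proof. by move=> C _; exists setT; [exact: vietoris_baseT|]. Qed.

Lemma vietoris_openI : setI_closed vietoris_open.
Proof.
move=> O O' oO oO' C [OC O'C].
have [B bB [BC BO]] := oO C OC; have [B' bB' [B'C BO']] := oO' C O'C.
exists (B `&` B'); first exact: vietoris_baseI.
by split=> // D [/BO ? /BO' ?].
Qed.

Lemma vietoris_open_bigU (I : Type) (f : I -> set hyperspace) :
  (forall i, vietoris_open (f i)) -> vietoris_open (\bigcup_i f i).
Proof.
move=> of_ C [i _ /of_ [B bB [BC Bf]]]; exists B => //.
by split=> // D /Bf; exists i.
Qed.

HB.instance Definition _ := gen_eqMixin hyperspace.
HB.instance Definition _ := gen_choiceMixin hyperspace.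
HB.instance Definition _ := isOpenTopological.Build hyperspace
  vietoris_openT vietoris_openI vietoris_open_bigU.

Lemma open_vietoris (O : set hyperspace) : vietoris_base O -> open O.
Proof. by move=> bO; change (vietoris_open O); exists O => //; split. Qed.

Lemma open_vietoris_sub (W : set X) :
  open W -> open [set C : hyperspace | C `<=` W].
Proof. by move=> oW; exact/open_vietoris/vietoris_base_sub. Qed.

Lemma open_vietoris_meet (V : set X) :
  open V -> open [set C : hyperspace | C `&` V !=set0].
Proof. by move=> oV; exact/open_vietoris/vietoris_base_meet. Qed.

Lemma vietoris_cvg (F : set_system hyperspace) C : Filter F ->
  (forall W : set X, open W -> C `<=` W -> F [set D : hyperspace | D `<=` W]) ->
  (forall V : set X, open V -> C `&` V !=set0 ->
    F [set D : hyperspace | D `&` V !=set0]) ->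
  F --> C.
Proof.
move=> FF Fsub Fmeet N [O [oO OC ON]].
have [B bB [BC BO]] := oO C OC; apply: filterS (subset_trans BO ON) _.
elim: bB BC {BO} => [_|W oW CW|V oV CV|P Q _ IP _ IQ [PC QC]].
- exact: filterT.
- exact: Fsub.
- exact: Fmeet.
- by apply: filterI; [exact: IP|exact: IQ].
Qed.

Lemma hyperspace_separate C (x : X) : ~ hset C x ->
  exists2 V, open V & V x /\ nbhs C [set D : hyperspace | D `&` V = set0].
Proof.
move=> nCx; have oC : open (~` hset C).
  by apply: closed_openC; exact: hset_closed.
have [N xN NC] := @flow_regular _ X x _ (open_nbhs_nbhs (conj oC nCx)).
exists N°; first exact: open_interior.
split; first exact: xN.
apply: (@filterS _ (nbhs C) _ [set D : hyperspace | D `<=` ~` closure N]).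
  move=> D DN; apply/seteqP; split=> // y [/DN nNy /interior_subset Ny].
  by apply: nNy; exact: subset_closure.
apply: open_nbhs_nbhs; split.
  by apply: open_vietoris_sub; apply: closed_openC; exact: closed_closure.
by move=> y Cy /NC.
Qed.

Lemma hyperspace_hausdorff : hausdorff_space hyperspace.
Proof.
suff sub C D : cluster (nbhs C) D -> C `<=` D.
  move=> C D CD; apply: hyperspace_inj; apply/seteqP; split; apply: sub => //.
  by move=> P Q DP CQ; rewrite setIC; exact: CD.
move=> CD x Cx; apply: contrapT => /hyperspace_separate[V oV [Vx DV]].
have CV : nbhs C [set E : hyperspace | E `&` V !=set0].
  apply: open_nbhs_nbhs; split; first exact: open_vietoris_meet.
  by exists x.
by have [E [[y EVy] EV]] := CD _ _ CV DV; rewrite EV in EVy.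
Qed.

(** The limit of an ultrafilter F consists of the points all of whose
    neighbourhoods V are met by F-almost every closed set; it is empty exactly
    when F is the principal ultrafilter of the empty set, an isolated point of
    the hyperspace. *)
Lemma hyperspace_compact : compact [set: hyperspace].
Proof.
rewrite compact_ultra => F UF _.
pose S := [set x : X | forall V : set X, open V -> V x ->
  F [set C : hyperspace | C `&` V !=set0]].
have cS : closed S.
  move=> x xS V oV Vx; have [y [Sy Vy]] := xS V (open_nbhs_nbhs (conj oV Vx)).
  exact: Sy.
have iS h x : nsg_set H h -> S x -> S (h *> x).
  move=> Hh Sx V oV Vx; apply: filterS (Sx _ (open_act h oV) Vx).
  by move=> C [y [Cy Vy]]; exists (h *> y); split=> //; exact: hset_invariant.
exists (Hyperspace cS iS); split=> //; apply: vietoris_cvg => [W oW SW|V oV [x [Sx Vx]]].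
  have cW : compact (~` W).
    by apply: subclosed_compact (@flow_compact _ X) _ => //; exact: open_closedC.
  have /compact_near_coveringP/(_ _ F (fun C x => ~ hset C x)) := cW.
  move=> nW; apply: filterS (nW _ _) => [C CW x Cx|x nWx].
    by apply: contrapT => /CW.
  have /existsNP[V /not_implyP[oV /not_implyP[Vx nF]]] : ~ S x by move=> /SW.
  have [//|FV] := in_ultra_setVsetC [set C : hyperspace | C `&` V !=set0] UF.
  exists (V, ~` [set C : hyperspace | C `&` V !=set0]).
    by split=> //=; exact: open_nbhs_nbhs.
  by move=> [y C] [/= Vy nCV] Cy; apply: nCV; exists y.
exact: Sx.
Qed.

(** The translate of a set by g, written as a preimage so that it is visibly
    closed. *)
Definition translate_set (g : G) C : set X := [set x | hset C (g^-1 *> x)].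

Lemma translate_closed g C : closed (translate_set g C).
Proof. by apply: closed_act; exact: hset_closed. Qed.

Lemma translate_invariant g C h x :
  nsg_set H h -> translate_set g C x -> translate_set g C (h *> x).
Proof.
move=> Hh Cx; rewrite /translate_set /= -flow_actM.
have -> : g^-1 * h = h ^ g * g^-1 by rewrite conjgE !mulgA mulgK.
by rewrite flow_actM; apply: hset_invariant => //; exact: nsgJ.
Qed.

Definition translate g C : hyperspace :=
  Hyperspace (@translate_closed g C) (@translate_invariant g C).

Lemma translate1 C : translate 1 C = C.
Proof.
by apply: hyperspace_inj; apply/funext => x; rewrite /= /translate_set /= invg1 flow_act1.
Qed.

Lemma translateM g k C : translate (g * k) C = translate g (translate k C).
Proof.
by apply: hyperspace_inj; apply/funext => x; rewrite /= /translate_set /= invgM flow_actM.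
Qed.

Lemma translate_fix h C : nsg_set H h -> translate h C = C.
Proof.
move=> Hh; apply: hyperspace_inj; apply/seteqP; split=> x; rewrite /= /translate_set /=.
  by move=> /(hset_invariant Hh); rewrite flow_actVK.
by apply: hset_invariant; exact: nsgV.
Qed.

(** Being contained in W is the statement that no point x of the compact
    complement of W satisfies g^-1 x in C, and this is an open condition on
    (g, C) locally uniformly in x. *)
Lemma translate_continuous :
  continuous (fun gC : G * hyperspace => translate gC.1 gC.2).
Proof.
move=> [g C]; apply: vietoris_cvg => /= [W oW CW|V oV [x [Cx Vx]]].
  have cW : compact (~` W).
    by apply: subclosed_compact (@flow_compact _ X) _ => //; exact: open_closedC.
  have /compact_near_coveringP/(_ _ (nbhs (g, C))
    (fun gC x => ~ translate_set gC.1 gC.2 x)) := cW.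
  move=> nW; apply: filterS (nW _ _) => [[k D] DW x Dx|x nWx].
    by apply: contrapT => /DW.
  have [V oV [Vx CV]] := @hyperspace_separate C (g^-1 *> x) (fun Cx => nWx (CW x Cx)).
  have [[A B] /= [Ag Bx] AB] := @flow_continuous _ X (g^-1, x) V
    (open_nbhs_nbhs (conj oV Vx)).
  exists (B, [set kD : G * hyperspace | A kD.1^-1 /\ kD.2 `&` V = set0]).
    split=> //=; exists ([set k | A k^-1], [set D : hyperspace | D `&` V = set0]).
      by split=> //=; exact: invg_continuous.
    by move=> [k D] [].
  move=> [y [k D]] /= [By [Ak DV]] Dy.
  by have : set0 (k^-1 *> y) by rewrite -DV; split=> //; exact: (AB (k^-1, y)).
have gx : V (g *> (g^-1 *> x)) by rewrite flow_actVK.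
have [[A B] /= [Ag]] := @flow_continuous _ X (g, g^-1 *> x) V
  (open_nbhs_nbhs (conj oV gx)).
move=> Bx AB.
exists (A, [set D : hyperspace | D `&` B° !=set0]) => /=.
  split=> //; apply: open_nbhs_nbhs; split.
    by apply: open_vietoris_meet; exact: open_interior.
  by exists (g^-1 *> x).
move=> [k D] /= [Ak [y [Dy /interior_subset By]]].
exists (k *> y); split; last exact: (AB (k, y)).
by rewrite /translate_set /= flow_actK.
Qed.

Local Notation K := (quotient_group H).

(** Elements of H fix every H-invariant set, so the choice of representative is
    immaterial. *)
Definition hyperspace_act (k : K) C : hyperspace := translate (repr k) C.

Lemma hyperspace_act_pi (g : G) C : hyperspace_act (\pi_K%qT g) C = translate g C.
Proof.
rewrite /hyperspace_act; set r := repr _.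
have Hr : nsg_set H (r^-1 * g) by exact: quotient_reprP.
have -> : g = r * (r^-1 * g) by rewrite mulgA mulgV mul1g.
by rewrite translateM (translate_fix _ Hr).
Qed.

Lemma hyperspace_act1 C : hyperspace_act 1 C = C.
Proof. by rewrite hyperspace_act_pi translate1. Qed.

Lemma hyperspace_actM k l C :
  hyperspace_act (k * l) C = hyperspace_act k (hyperspace_act l C).
Proof.
elim/quotient_ind: k => g; elim/quotient_ind: l => h.
rewrite (_ : \pi_K%qT g * \pi_K%qT h = \pi_K%qT (g * h)); last exact: quotient_mulE.
by rewrite !hyperspace_act_pi translateM.
Qed.

Lemma hyperspace_act_continuous :
  continuous (fun kC : K * hyperspace => hyperspace_act kC.1 kC.2).
Proof.
move=> [k C]; elim/quotient_ind: k => g N.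
rewrite /= hyperspace_act_pi => gN.
have [[A B] /= [Ag BC] AB] := @translate_continuous (g, C) N gN.
exists (\pi_K%qT @` A, B) => /=.
  split=> //; apply: (@filterS _ _ _ (\pi_K%qT @` A°)).
    by move=> _ [h /interior_subset Ah <-]; exists h.
  apply: open_nbhs_nbhs; split; last by exists g.
  by apply: quotient_cls_open; exact: open_interior.
move=> [_ D] /= [[h Ah <-] BD]; rewrite hyperspace_act_pi.
exact: (AB (h, D)).
Qed.

Definition hyperspace_flow : flow (quotient_group H) :=
  Flow hyperspace_compact hyperspace_hausdorff
    (compact_hausdorff_regular hyperspace_compact hyperspace_hausdorff)
    hyperspace_act1 hyperspace_actM hyperspace_act_continuous.

End InvariantHyperspace.

(** * Extensions *)

Definition nsg_elt (G : topologicalGroupType) (H : normalSubgroup G) (x : G)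
  (Hx : nsg_set H x) : set_type H := exist _ x (mem_set Hx).

Section Restriction.
Context (G : topologicalGroupType) (H : normalSubgroup G) (X : flow G).

Definition restrict_act (h : set_type H) (x : X) : X := set_val h *> x.

Lemma restrict_continuous :
  continuous (fun hx : set_type H * X => restrict_act hx.1 hx.2).
Proof.
move=> [h x] N Nx.
have [[A B] /= [Ah Bx] AB] := @flow_continuous _ X (set_val h, x) N Nx.
exists (set_val @^-1` A, B) => /=.
  by split=> //; exact: (@subgroup_val_continuous _ H h A Ah).
by move=> [k y] /= [Ak By]; exact: (AB (set_val k, y)).
Qed.

Definition restrict_flow : flow (set_type H) :=
  @Flow (set_type H) X restrict_act (@flow_compact _ X) (@flow_hausdorff _ X)
    (@flow_regular _ X) (@flow_act1 _ X)
    (fun h k x => @flow_actM _ X (set_val h) (set_val k) x) restrict_continuous.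

(** Normality of H: conjugation by g turns the H-orbit of x into that of g x. *)
Lemma restrict_minimal_translate (g : G) (Y Y' : set X) :
  (forall x, Y' x <-> Y (g^-1 *> x)) ->
  minimal_set (X := restrict_flow) Y -> minimal_set (X := restrict_flow) Y'.
Proof.
move=> YY' [cY [y Yy] iY mY].
have -> : Y' = [set x | Y (g^-1 *> x)] by apply/seteqP; split=> x /YY'.
split.
- exact: (@closed_act _ X).
- by exists (g *> y); rewrite /= flow_actK.
- move=> h x Yx.
  change (Y (g^-1 *> (set_val h *> (x : X)))); rewrite -flow_actM.
  have Hh : nsg_set H (set_val h ^ g) by exact: nsgJ (nsg_valP h).
  have : Y ((set_val h ^ g) *> (g^-1 *> (x : X))) :=
    iY (nsg_elt Hh) _ Yx.
  by rewrite -flow_actM conjgE !mulgA mulgK.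
- move=> x Yx z Yz N zN.
  have [|_ [[h _ <-] Nh]] := mY _ Yx _ Yz [set w | N (g *> w)].
    by apply: (@flow_act_continuous _ X); rewrite flow_actVK.
  have Hh : nsg_set H (set_val h ^ g^-1) by exact: nsgJ (nsg_valP h).
  exists (g *> (set_val h *> (g^-1 *> x))); split=> //.
  exists (nsg_elt Hh) => //.
  change (set_val h ^ g^-1 *> (x : X) = g *> (set_val h *> (g^-1 *> (x : X)))).
  by rewrite -!flow_actM conjgE invgK !mulgA.
Qed.

End Restriction.

Lemma symmetric_nbhs_subgroup (G : topologicalGroupType) (H : normalSubgroup G)
    (U : set G) : symmetric_open_nbhs1 U ->
  symmetric_open_nbhs1 (set_val @^-1` U : set (set_type H)).
Proof.
move=> [oU U1 UV]; split=> //; last by move=> h /UV.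
by apply: open_comp => // h _; exact: subgroup_val_continuous.
Qed.

Lemma symmetric_nbhs_quotient (G : topologicalGroupType) (H : normalSubgroup G)
    (U : set G) : symmetric_open_nbhs1 U ->
  symmetric_open_nbhs1 (\pi_(quotient_group H)%qT @` U).
Proof.
move=> [oU U1 UV]; split; first exact: quotient_cls_open.
  by exists 1.
by move=> _ [u /UV Uu <-]; exists u^-1 => //; rewrite -quotient_invE.
Qed.

Section Extension.
Context (G : topologicalGroupType) (H : normalSubgroup G) (X : flow G).
Hypothesis minX : minimal_flow X.
Local Notation K := (quotient_group H).
Local Notation XH := (restrict_flow H X).
Local Notation HX := (hyperspace_flow H X).

Definition pull (s : seq G) (V : set X) := [set x | forall f, f \in s -> V (f *> x)].

Lemma open_pull s V : open V -> open (pull s V).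
Proof. by move=> oV; apply: open_seqI => f _; exact: open_act. Qed.

Lemma hyperspace_act_translate (g : G) (C : HX) :
  flow_act (\pi_K%qT g) C = translate g C.
Proof. exact: hyperspace_act_pi. Qed.

(** Fix an H-minimal set Y in X and a G/H-minimal set Z of Vietoris limits of
    translates of Y. Linking in Z produces a translate g Y and an element w of
    U1 such that g Y has a point whose FH-translates lie in V and w g Y has a
    point whose FH-translates lie in W. Moving the latter point back into g Y
    by w^-1 costs a conjugate of w by FH, which lies in U0, and linking in the
    H-minimal set g Y finishes the argument. *)
Lemma extension_linked (U0 U1 : set G) (FH : seq (set_type H)) (FK : seq K) :
  symmetric_open_nbhs1 U0 ->
  (forall f w, f \in FH -> U1 w -> U0 (set_val f * w * (set_val f)^-1)) ->
  (forall A : set XH, minimal_set A -> linked (set_val @^-1` U0) FH A) ->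
  (forall A : set HX, minimal_set A -> linked (\pi_K%qT @` U1) FK A) ->
  linked [set u * v | u in U0 & v in U0] [seq set_val f * repr k | f <- FH, k <- FK]
    [set: X].
Proof.
move=> [_ _ U0V] U1conj linkH linkK x y V W _ _ oV oW FV FW.
have [n0 _] := minX; have mX := minimal_flow_setT minX.
have [||Y _ mY] := @minimal_set_exists _ XH setT closedT; [by []|by []|].
have [cY [y0 Yy0] iY _] := mY.
have iY' (h : G) (x' : X) : nsg_set H h -> Y x' -> Y (h *> x').
  by move=> Hh; exact: (iY (nsg_elt Hh)).
pose C0 : HX := @Hyperspace G H X Y cY iY'.
have [|||Z ZC mZ] := @minimal_set_exists _ HX (closure (flow_orbit C0)).
- exact: closed_closure.
- exact/closure_invariant/flow_orbit_invariant.
- by exists C0; apply: subset_closure; exact: flow_orbit_refl.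
have [_ [S0 ZS0] iZ _] := mZ.
have approx (O : set HX) S : open O -> Z S -> O S -> exists g, O (translate g C0).
  move=> oO /ZC ZS OS; have [_ [[k _ <-] OC]] := ZS O (open_nbhs_nbhs (conj oO OS)).
  by exists (repr k).
(* The empty set is isolated in the hyperspace and is no translate of Y. *)
have [x0 S0x0] : hset S0 !=set0.
  apply: contrapT => nS0.
  have [|||g] := approx [set C : HX | C `<=` set0] S0.
  - by apply: open_vietoris_sub; exact: open0.
  - by [].
  - by move=> z Sz; apply: nS0; exists z.
  move=> /(_ (g *> y0)); rewrite /= /translate_set /= flow_actK; exact.
pose F := [seq set_val f * repr k | f <- FH, k <- FK].
pose VH := [seq set_val f | f <- FH].
(* By density of the orbit of x0, some translate of S0 has a point near z, and
   the F-translates of that point still lie in O. *)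
have meet (O : set X) z : open O -> (forall f, f \in F -> O (f *> z)) ->
    exists S, Z S /\ forall k, k \in FK ->
      [set C : HX | C `&` pull VH O !=set0] (flow_act k S).
  move=> oO FO.
  have [|g gx0] := minimal_setP (x := x0) mX I (open_pull F oO).
    by exists z; split=> // f /FO.
  exists (flow_act (\pi_K%qT g) S0); split; first exact: iZ.
  move=> k sk; exists (repr k *> (g *> x0)); split.
    by rewrite hyperspace_act_translate; rewrite /= /translate_set /= !flow_actK.
  move=> _ /mapP[f sf ->]; rewrite -flow_actM; apply: gx0.
  exact: allpairs_f.
have [S [ZS SV]] := meet V x oV FV; have [T [ZT TW]] := meet W y oW FW.
have oM (O : set X) : open O -> open [set C : HX | C `&` pull VH O !=set0].
  by move=> oO; apply: open_vietoris_meet; exact: open_pull.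
have [_ [S' [[w U1w <-] ZS' S'V S'W]]] :=
  linkK Z mZ S T _ _ ZS ZT (oM V oV) (oM W oW) SV TW.
(* Points of Z are limits of translates of Y, and the conditions on S' are
   open. *)
have [|||g [[p [gp pV]] [q [gq qW]]]] := approx ([set C : HX | C `&` pull VH V !=set0] `&`
   [set C : HX | flow_act (\pi_K%qT w) C `&` pull VH W !=set0]) S'.
- by apply: openI; [exact: oM|exact: (@open_act _ HX (\pi_K%qT w) _ (oM W oW))].
- by [].
- by [].
rewrite hyperspace_act_translate in gq.
have mgY : minimal_set (X := XH) (translate g C0).
  exact: (@restrict_minimal_translate _ _ _ g Y).
pose q' := w^-1 *> q.
have [||u [v [U0u gv Vv [u' U0u' [z Wz zE]]]]] := linkH _ mgY p q' V
    (flow_translates U0 W) gp gq oV (open_translates _ oW).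
- by move=> f sf; apply: pV; exact: map_f.
- move=> f sf; exists (set_val f * w^-1 * (set_val f)^-1).
    by have := U0V _ (U1conj f w sf U1w); rewrite !invgM invgK mulgA.
  exists (set_val f *> q); first by apply: qW; exact: map_f.
  by rewrite /q' -!flow_actM mulgVK flow_actM.
exists (u'^-1 * set_val u), v; split=> //.
  by exists u'^-1; [exact: U0V|exists (set_val u)].
by rewrite flow_actM -[set_val u *> v]zE flow_actK.
Qed.

End Extension.

Theorem theorem6p5 (G : topologicalGroupType)
    (G_hausdorff : hausdorff_space G) (G_regular : regular_space G)
    (H : normalSubgroup G) (H_closed : closed (H : set G))
    (H_TMD : TMD (set_type H)) (GH_TMD : TMD (quotient_group H)) :
  TMD G.
Proof.
have [M [mM uM]] := universal_minimal_flow_exists G.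
exists M; split; first by split.
apply: linked_rosendal => // U sU.
have [U0 sU0 U0U] := symmetric_sqrt sU.
have [FH linkH] := TMD_linked H_TMD (symmetric_nbhs_subgroup H sU0).
have [U1 sU1 U1U0] := symmetric_conj [seq set_val f | f <- FH] sU0.
have [FK linkK] := TMD_linked GH_TMD (symmetric_nbhs_quotient H sU1).
exists [seq set_val f * repr k | f <- FH, k <- FK] => x y V W Mx My oV oW FV FW.
have [|_ [v [[u1 U0u1 [u2 U0u2 <-]] Mv Vv Wv]]] :=
  @extension_linked G H M mM U0 U1 FH FK sU0 _ (linkH _) (linkK _)
    x y V W Mx My oV oW FV FW.
  by move=> f w sf; apply: U1U0; exact: map_f.
by exists (u1 * u2), v; split=> //; exact: U0U.
Qed.
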